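(* Let $(R,q)$ be an operated algebra whose operator $q$ satisfies $q(\mathbf 1_R)=0$. For a given $\omega=xy-(\phi(x)+y\psi(x))\in\Omega$ with $\phi,\psi\in\mathbf k[x]$, $q$ has a unique extension $\hat q^{\,\omega}:\mathrm{Sh}(R)\to\mathrm{Sh}(R)$ with the following property: for $u=u_0\otimes u'\in R^{\otimes(n+1)}$ with $u_0\in R$, $u'\in R^{\otimes n}$ ($n\in\mathbb N_+$), $$\hat q^{\,\omega}(u)=q(u_0)\otimes u'+(u_0+\lambda q(u_0))\big(\phi(\hat q^{\,\omega})+P_R\psi(\hat q^{\,\omega})\big)(u')$$ and $$\hat q^{\,\omega}\Big(\bigoplus_{i=1}^nR^{\otimes i}\Big)\subseteq\bigoplus_{i=1}^nR^{\otimes i}\quad\text{for each }n\in\mathbb N_+.$$ Therefore $$\hat q^{\,\omega}P_R=\phi(\hat q^{\,\omega})+P_R\psi(\hat q^{\,\omega}),$$ and then the triple $(\mathrm{Sh}(R),\hat q^{\,\omega},P_R)$ is a type $\omega$ operated Rota-Baxter algebra of weight $\lambda$.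
   Context: $\mathbf k$ is a fixed commutative ring with identity and $\lambda\in\mathbf k$ is fixed. All algebras are commutative $\mathbf k$-algebras with identity and all operators are $\mathbf k$-linear. $\mathbb N_+=\{1,2,\dots\}$. An operated algebra is an algebra with an operator. Products of operators are compositions; for $\phi\in\mathbf k[x]$ and an operator $q$, $\phi(q)$ is the usual evaluation (constant terms multiply the identity operator). A Rota-Baxter operator of weight $\lambda$ on $R$ is an operator $P$ with $P(x)P(y)=P(P(x)y)+P(xP(y))+\lambda P(xy)$ for all $x,y\in R$; $(R,P)$ is then a Rota-Baxter algebra of weight $\lambda$. $\Omega=\{xy-(\phi(x)+y\psi(x))\mid\phi,\psi\in\mathbf k[x]\}\subset\mathbf k\langle x,y\rangle$ (noncommuting variables). For $\omega=xy-(\phi(x)+y\psi(x))$, $\omega(q,P)=0$ means $qP=\phi(q)+P\psi(q)$. A type $\omega$ operated Rota-Baxter algebra of weight $\lambda$ is a triple $(R,q,P)$ with $q$ an operator on $R$ satisfying $q(\mathbf 1_R)=0$, $(R,P)$ a Rota-Baxter algebra of weight $\lambda$, and $\omega(q,P)=0$. For an algebra $R$, $\mathrm{Sh}(R)=\bigoplus_{i\in\mathbb N_+}R^{\otimes i}$ (tensors over $\mathbf k$) with the mixable shuffle product $\diamond$ (written by juxtaposition): for $\mathfrak a=a_0\otimes\cdots\otimes a_m$, $\mathfrak b=b_0\otimes\cdots\otimes b_n$, if $m=0$ then $\mathfrak a\diamond\mathfrak b=(a_0b_0)\otimes b_1\otimes\cdots\otimes b_n$; if $n=0$ then $\mathfrak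 a\diamond\mathfrak b=(a_0b_0)\otimes a_1\otimes\cdots\otimes a_m$; and if $m,n>0$, inductively, $\mathfrak a\diamond\mathfrak b=(a_0b_0)\otimes\big((a_1\otimes\cdots\otimes a_m)\diamond(\mathbf 1_R\otimes b_1\otimes\cdots\otimes b_n)+(\mathbf 1_R\otimes a_1\otimes\cdots\otimes a_m)\diamond(b_1\otimes\cdots\otimes b_n)+\lambda(a_1\otimes\cdots\otimes a_m)\diamond(b_1\otimes\cdots\otimes b_n)\big)$. The operator $P_R(x_0\otimes\cdots\otimes x_n)=\mathbf 1_R\otimes x_0\otimes\cdots\otimes x_n$ makes $(\mathrm{Sh}(R),P_R)$ the free Rota-Baxter algebra of weight $\lambda$ on $R$. An extension of $q:R\to R$ (with $q(\mathbf 1_R)=0$) to $\mathrm{Sh}(R)$ is an operator $\hat q$ on $\mathrm{Sh}(R)$ with $\hat q|_R=q$. *)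

(* Defs.v *)
From HB Require Import structures.
From mathcomp Require Import all_boot all_algebra.
From mathcomp Require Import boolp.

Set Implicit Arguments.
Unset Strict Implicit.
Unset Printing Implicit Defensive.

Import GRing.Theory.
Local Open Scope ring_scope.
Local Open Scope quotient_scope.

(* A formal sum of symbols m (x) n is a list of pairs; scalars are absorbed in
   the first factor, so c *: (m (x) n) is (c *: m) (x) n. *)
Inductive tens_eq (k : comNzRingType) (M N : lmodType k) :
  seq (M * N) -> seq (M * N) -> Prop :=
| TensRefl s : tens_eq s s
| TensSym s t : tens_eq s t -> tens_eq t s
| TensTrans s t u : tens_eq s t -> tens_eq t u -> tens_eq s u
| TensCat s s' t t' : tens_eq s s' -> tens_eq t t' -> tens_eq (s ++ t) (s' ++ t')
| TensCatC s t : tens_eq (s ++ t) (t ++ s)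
| Tens0 n : tens_eq [:: (0, n)] [::]
| TensDl m m' n : tens_eq [:: (m + m', n)] [:: (m, n); (m', n)]
| TensDr m n n' : tens_eq [:: (m, n + n')] [:: (m, n); (m, n')]
| TensZ c m n : tens_eq [:: (c *: m, n)] [:: (m, c *: n)].

Section Tensor.
Variables (k : comNzRingType) (M N : lmodType k).

Definition tens_rel (s t : seq (M * N)) : bool := `[< tens_eq s t >].

Lemma tens_rel_refl : reflexive tens_rel.
Proof. by move=> s; apply/asboolP/TensRefl. Qed.

Lemma tens_rel_sym : symmetric tens_rel.
Proof. by move=> s t; apply/asboolP/asboolP => /TensSym. Qed.

Lemma tens_rel_trans : transitive tens_rel.
Proof.
by move=> t s u /asboolP st /asboolP tu; apply/asboolP/(TensTrans st tu).
Qed.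

Canonical tens_equiv :=
  EquivRel tens_rel tens_rel_refl tens_rel_sym tens_rel_trans.

Definition tensor := {eq_quot tens_equiv}.
HB.instance Definition _ := Choice.on tensor.
HB.instance Definition _ := EqQuotient.on tensor.

Lemma tens_piP (s t : seq (M * N)) :
  reflect (\pi_tensor s = \pi_tensor t) `[< tens_eq s t >].
Proof.
exact: (@eqmodP _ tens_equiv s t).
Qed.

Lemma tens_piE (s t : seq (M * N)) : tens_eq s t -> \pi_tensor s = \pi_tensor t.
Proof. by move=> st; apply/tens_piP/asboolP. Qed.

Lemma tens_reprP (s : seq (M * N)) : tens_eq (repr (\pi_tensor s)) s.
Proof. by apply/asboolP/tens_piP; rewrite reprK. Qed.

Let scale_seq (c : k) (s : seq (M * N)) := [seq (c *: p.1, p.2) | p <- s].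

Lemma scale_seqP c s t :
  tens_eq s t -> tens_eq (scale_seq c s) (scale_seq c t).
Proof.
rewrite /scale_seq; elim=> {s t} /=.
- by move=> s; apply: TensRefl.
- by move=> s t _; apply: TensSym.
- by move=> s t u _ + _; apply: TensTrans.
- by move=> s s' t t' _ + _; rewrite !map_cat; apply: TensCat.
- by move=> s t; rewrite !map_cat; apply: TensCatC.
- by move=> n; rewrite scaler0; apply: Tens0.
- by move=> m m' n; rewrite scalerDr; apply: TensDl.
- by move=> m n n'; apply: TensDr.
- by move=> d m n; rewrite scalerA mulrC -scalerA; apply: TensZ.
Qed.

Definition tens0 : tensor := \pi_tensor [::].
Definition tens_add (x y : tensor) : tensor := \pi_tensor (repr x ++ repr y).
Definition tens_scale (c : k) (x : tensor) : tensor :=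
  \pi_tensor (scale_seq c (repr x)).
Definition tens_opp (x : tensor) : tensor := tens_scale (-1) x.

Lemma tens_add_pi s t :
  tens_add (\pi_tensor s) (\pi_tensor t) = \pi_tensor (s ++ t).
Proof. by apply/tens_piE/TensCat; apply: tens_reprP. Qed.

Lemma tens_scale_pi c s :
  tens_scale c (\pi_tensor s) = \pi_tensor (scale_seq c s).
Proof. by apply/tens_piE/scale_seqP/tens_reprP. Qed.

Lemma tens_addA : associative tens_add.
Proof.
elim/quotW=> s; elim/quotW=> t; elim/quotW=> u.
by rewrite (tens_add_pi t u) (tens_add_pi s t) !tens_add_pi catA.
Qed.

Lemma tens_addC : commutative tens_add.
Proof. by move=> x y; apply/tens_piE/TensCatC. Qed.

Lemma tens_add0 : left_id tens0 tens_add.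
Proof. by elim/quotW=> s; rewrite tens_add_pi. Qed.

Lemma tens_scaleDl x (a b : k) :
  tens_scale (a + b) x = tens_add (tens_scale a x) (tens_scale b x).
Proof.
elim/quotW: x => x; rewrite !tens_scale_pi tens_add_pi; apply: tens_piE.
elim: x => [|[m n] s IH] /=; first exact: TensRefl.
rewrite scalerDl.
apply: (TensTrans (TensCat (TensDl _ _ _) IH)) => /=.
apply: (@TensCat _ _ _ [:: (a *: m, n)] [:: (a *: m, n)]).
  exact: TensRefl.
rewrite -cat_rcons -cats1 -cat_cons -cat1s.
by apply: TensCat; [apply: TensCatC|apply: TensRefl].
Qed.

Lemma tens_scale0 x : tens_scale 0 x = tens0.
Proof.
elim/quotW: x => x; rewrite tens_scale_pi; apply: tens_piE.
elim: x => [|[m n] s IH] /=; first exact: TensRefl.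
rewrite scale0r; apply: (@TensCat _ _ _ [:: (0, n)] [::] _ [::] _ IH).
exact: Tens0.
Qed.

Lemma tens_scale1 : left_id 1 tens_scale.
Proof.
elim/quotW=> x; rewrite tens_scale_pi /scale_seq; congr (\pi_tensor _).
by elim: x => [|[m n] s /= ->] //; rewrite scale1r.
Qed.

Lemma tens_addN : left_inverse tens0 tens_opp tens_add.
Proof.
move=> x; rewrite /tens_opp -{2}[x]tens_scale1 -tens_scaleDl.
by rewrite addNr tens_scale0.
Qed.

HB.instance Definition _ := GRing.isZmodule.Build tensor
  tens_addA tens_addC tens_add0 tens_addN.

Lemma tens_scaleA (a b : k) (x : tensor) :
  tens_scale a (tens_scale b x) = tens_scale (a * b) x.
Proof.
elim/quotW: x => x; rewrite (tens_scale_pi b) !tens_scale_pi /scale_seq -map_comp.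
by congr (\pi_tensor _); apply: eq_map => -[m n] /=; rewrite scalerA.
Qed.

Lemma tens_scaleDr : right_distributive tens_scale +%R.
Proof.
move=> c; elim/quotW=> s; elim/quotW=> t.
transitivity (tens_scale c (\pi_tensor (s ++ t))).
  by congr tens_scale; apply: tens_add_pi.
rewrite (tens_scale_pi c s) (tens_scale_pi c t) tens_scale_pi.
by rewrite /scale_seq map_cat; apply/esym/tens_add_pi.
Qed.

HB.instance Definition _ := GRing.Zmodule_isLmodule.Build k tensor
  tens_scaleA tens_scale1 tens_scaleDr (fun x a b => tens_scaleDl x a b).

Definition pure (m : M) (n : N) : tensor := \pi_tensor [:: (m, n)].

Lemma pureDl m m' n : pure (m + m') n = pure m n + pure m' n.
Proof. by rewrite [RHS]tens_add_pi; apply/tens_piE/TensDl. Qed.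

Lemma pureDr m n n' : pure m (n + n') = pure m n + pure m n'.
Proof. by rewrite [RHS]tens_add_pi; apply/tens_piE/TensDr. Qed.

Lemma pureZl c m n : pure (c *: m) n = c *: pure m n.
Proof. by rewrite [RHS]tens_scale_pi. Qed.

Lemma pureZr c m n : pure m (c *: n) = c *: pure m n.
Proof. by rewrite -pureZl; apply/esym/tens_piE/TensZ. Qed.

Lemma pure0l n : pure 0 n = 0.
Proof. by rewrite -(scale0r (0 : M)) pureZl scale0r. Qed.

Lemma pure0r m : pure m 0 = 0.
Proof. by rewrite -(scale0r (0 : N)) pureZr scale0r. Qed.

Lemma tensorE (x : tensor) : x = \sum_(p <- repr x) pure p.1 p.2.
Proof.
rewrite -{1}[x]reprK; elim: (repr x) => [|[m n] s IH].
  by rewrite big_nil.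
by rewrite big_cons -IH [RHS]tens_add_pi.
Qed.

Lemma tensor_ind (Q : tensor -> Prop) :
  Q 0 -> (forall x y, Q x -> Q y -> Q (x + y)) ->
  (forall m n, Q (pure m n)) -> forall x, Q x.
Proof. by move=> Q0 QD Qp x; rewrite [x]tensorE; apply: big_ind. Qed.

(* The linear map induced by f; meaningful when f is bilinear, see tliftE. *)
Definition tlift (L : lmodType k) (f : M -> N -> L) (x : tensor) : L :=
  \sum_(p <- repr x) f p.1 p.2.

Section Lift.
Variables (L : lmodType k) (f : M -> N -> L).
Hypothesis fl : forall n, linear (f^~ n).
Hypothesis fr : forall m, linear (f m).

Let fDl m m' n : f (m + m') n = f m n + f m' n.
Proof. by have := fl n 1 m m'; rewrite !scale1r. Qed.
Let fDr m n n' : f m (n + n') = f m n + f m n'.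
Proof. by have := fr m 1 n n'; rewrite !scale1r. Qed.
Let f0l n : f 0 n = 0.
Proof. by apply: (addrI (f 0 n)); rewrite -fDl !addr0. Qed.
Let f0r m : f m 0 = 0.
Proof. by apply: (addrI (f m 0)); rewrite -fDr !addr0. Qed.
Let fZl c m n : f (c *: m) n = c *: f m n.
Proof. by have := fl n c m 0; rewrite !addr0 f0l addr0. Qed.
Let fZr c m n : f m (c *: n) = c *: f m n.
Proof. by have := fr m c n 0; rewrite !addr0 f0r addr0. Qed.

Let eval (s : seq (M * N)) := \sum_(p <- s) f p.1 p.2.

Let evalP s t : tens_eq s t -> eval s = eval t.
Proof.
rewrite /eval; elim=> {s t} //=.
- by move=> s t u _ -> _ ->.
- by move=> s s' t t' _ + _; rewrite !big_cat /= => -> ->.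
- by move=> s t; rewrite !big_cat /= addrC.
- by move=> n; rewrite big_seq1 big_nil f0l.
- by move=> m m' n; rewrite big_seq1 big_cons big_seq1 fDl.
- by move=> m n n'; rewrite big_seq1 big_cons big_seq1 fDr.
- by move=> c m n; rewrite !big_seq1 /= fZl fZr.
Qed.

Lemma tliftE m n : tlift f (pure m n) = f m n.
Proof. by rewrite [LHS](evalP (tens_reprP _)) /eval big_seq1. Qed.

Lemma tlift_is_linear : linear (tlift f).
Proof.
move=> c; elim/quotW=> s; elim/quotW=> t.
have -> : c *: \pi_tensor s + \pi_tensor t
    = \pi_tensor ([seq (c *: p.1, p.2) | p <- s] ++ t).
  by rewrite -tens_add_pi -tens_scale_pi.
rewrite /tlift -![\sum_(p <- repr _) _]/(eval _) !(evalP (tens_reprP _)).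
rewrite /eval big_cat /= big_map /= scaler_sumr; congr (_ + _).
by apply: eq_bigr => p _; rewrite fZl.
Qed.

End Lift.
End Tensor.

Record dsum (k : comNzRingType) (V : nat -> lmodType k) := DSum {
  dcoef :> forall i, V i;
  dsumP : exists n, forall i, (n <= i)%N -> dcoef i = 0 }.

Section DirectSum.
Variables (k : comNzRingType) (V : nat -> lmodType k).
Local Notation D := (dsum V).

HB.instance Definition _ := gen_eqMixin D.
HB.instance Definition _ := gen_choiceMixin D.

Lemma dsum_ext (x y : D) : (forall i, x i = y i) -> x = y.
Proof.
case: x y => [x xP] [y yP] /= xy.
have {}xy : x = y by apply: functional_extensionality_dep.
by case: _ / xy in yP *; congr DSum; apply: Prop_irrelevance.
Qed.

Lemma dsum0_subproof :
  exists n : nat, forall i : nat, (n <= i)%N -> (0 : V i) = 0.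
Proof. by exists 0. Qed.
Definition dsum0 : D := DSum dsum0_subproof.

Lemma dsum_add_subproof (x y : D) :
  exists n : nat, forall i : nat, (n <= i)%N -> x i + y i = 0.
Proof.
case: x y => [x [m xm]] [y [n yn]]; exists (maxn m n) => i /=.
by rewrite geq_max => /andP[/xm -> /yn ->]; rewrite addr0.
Qed.
Definition dsum_add (x y : D) : D := DSum (dsum_add_subproof x y).

Lemma dsum_scale_subproof (c : k) (x : D) :
  exists n : nat, forall i : nat, (n <= i)%N -> c *: x i = 0.
Proof. by case: x => [x [m xm]]; exists m => i /= /xm ->; rewrite scaler0. Qed.
Definition dsum_scale (c : k) (x : D) : D := DSum (dsum_scale_subproof c x).

Lemma dsum_addA : associative dsum_add.
Proof. by move=> x y z; apply: dsum_ext => i /=; rewrite addrA. Qed.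
Lemma dsum_addC : commutative dsum_add.
Proof. by move=> x y; apply: dsum_ext => i /=; rewrite addrC. Qed.
Lemma dsum_add0 : left_id dsum0 dsum_add.
Proof. by move=> x; apply: dsum_ext => i /=; rewrite add0r. Qed.
Lemma dsum_addN : left_inverse dsum0 (dsum_scale (-1)) dsum_add.
Proof. by move=> x; apply: dsum_ext => i /=; rewrite scaleN1r addNr. Qed.

HB.instance Definition _ := GRing.isZmodule.Build D
  dsum_addA dsum_addC dsum_add0 dsum_addN.

Lemma dsum_scaleA (a b : k) (x : D) :
  dsum_scale a (dsum_scale b x) = dsum_scale (a * b) x.
Proof. by apply: dsum_ext => i /=; rewrite scalerA. Qed.
Lemma dsum_scale1 : left_id 1 dsum_scale.
Proof. by move=> x; apply: dsum_ext => i /=; rewrite scale1r. Qed.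
Lemma dsum_scaleDr : right_distributive dsum_scale +%R.
Proof. by move=> c x y; apply: dsum_ext => i /=; rewrite scalerDr. Qed.
Lemma dsum_scaleDl x : {morph dsum_scale^~ x : a b / a + b}.
Proof. by move=> a b; apply: dsum_ext => i /=; rewrite scalerDl. Qed.

HB.instance Definition _ := GRing.Zmodule_isLmodule.Build k D
  dsum_scaleA dsum_scale1 dsum_scaleDr dsum_scaleDl.

Lemma dcoef0 i : (0 : D) i = 0. Proof. by []. Qed.
Lemma dcoefD (x y : D) i : (x + y) i = x i + y i. Proof. by []. Qed.
Lemma dcoefZ c (x : D) i : (c *: x) i = c *: x i. Proof. by []. Qed.
Lemma dcoef_sum I (r : seq I) (F : I -> D) i :
  (\sum_(j <- r) F j) i = \sum_(j <- r) F j i.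
Proof. by elim/big_rec2: _ => //= j y1 y2 _ <-. Qed.

Lemma dinj_subproof i (x : V i) :
  exists n : nat, forall j : nat, (n <= j)%N ->
    @dfwith nat V (fun=> 0) i x j = 0.
Proof.
by exists i.+1 => j ij; rewrite dfwith_out //; move: ij; case: ltngtP.
Qed.
Definition dinj i (x : V i) : D := DSum (dinj_subproof x).

Lemma dinjE i (x : V i) : dinj x i = x.
Proof. by rewrite /= dfwith_in. Qed.

Lemma dinjNE i (x : V i) j : i != j -> dinj x j = 0.
Proof. by move=> ij; rewrite /= dfwith_out. Qed.

Lemma dinj_is_linear i : linear (@dinj i).
Proof.
move=> c x y; apply: dsum_ext => j; rewrite dcoefD dcoefZ.
have [ij|ij] := eqVneq i j; first by case: _ / ij; rewrite !dinjE.
by rewrite !dinjNE // scaler0 addr0.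
Qed.
HB.instance Definition _ i :=
  GRing.isLinear.Build k (V i) D *:%R (@dinj i) (@dinj_is_linear i).

Definition dbound (x : D) : nat := projT1 (cid (dsumP x)).
Lemma dboundP (x : D) i : (dbound x <= i)%N -> x i = 0.
Proof. by rewrite /dbound; case: cid => n /= nP /nP. Qed.

Lemma dsumE (x : D) n : (forall i, (n <= i)%N -> x i = 0) ->
  x = \sum_(i < n) dinj (x i).
Proof.
move=> xn; apply: dsum_ext => j; rewrite dcoef_sum.
have [jn|nj] := ltnP j n; last first.
  rewrite xn // big1 // => i _.
  by rewrite dinjNE // ltn_eqF // (leq_trans _ nj).
rewrite (bigD1 (Ordinal jn)) //= dfwith_in big1 ?addr0 // => i ij.
by rewrite dfwith_out.
Qed.

(* The linear map induced by linear maps f i. *)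
Definition dlift (L : lmodType k) (f : forall i, V i -> L) (x : D) : L :=
  \sum_(i < dbound x) @f i (x i).

Section Lift.
Variables (L : lmodType k) (f : forall i, V i -> L).
Hypothesis fL : forall i, linear (@f i).

Let f0 i : @f i 0 = 0.
Proof.
have := @fL i 1 0 0; rewrite !scale1r !addr0 => f00.
by apply: (addrI (@f i 0)); rewrite -f00 addr0.
Qed.

Lemma dliftE (x : D) n : (forall i, (n <= i)%N -> x i = 0) ->
  dlift f x = \sum_(i < n) @f i (x i).
Proof.
have gen (m p : nat) : (forall i, (m <= i)%N -> x i = 0) -> (m <= p)%N ->
    \sum_(i < m) @f i (x i) = \sum_(i < p) @f i (x i).
  move=> xm mp; rewrite -!(big_mkord xpredT (fun i => @f i (x i))).
  rewrite [RHS](big_cat_nat _ mp) //= [X in _ = _ + X]big_nat_cond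
    [X in _ = _ + X]big1 ?addr0 //.
  by move=> i /andP[/andP[mi _] _]; rewrite xm.
move=> xn; rewrite /dlift (gen _ _ (@dboundP x) (leq_maxl _ n)).
by rewrite (gen _ _ xn (leq_maxr (dbound x) _)).
Qed.

Lemma dlift_inj i (x : V i) : dlift f (dinj x) = @f i x.
Proof.
rewrite (@dliftE _ i.+1) => [|j ij]; last first.
  by rewrite dinjNE // ltn_eqF.
rewrite (bigD1 (Ordinal (ltnSn i))) //= dfwith_in big1 ?addr0 // => j ij.
by rewrite dfwith_out // eq_sym.
Qed.

Lemma dlift_is_linear : linear (dlift f).
Proof.
move=> c x y; pose n := maxn (dbound x) (dbound y).
have xn i : (n <= i)%N -> x i = 0.
  by rewrite geq_max => /andP[/dboundP].
have yn i : (n <= i)%N -> y i = 0.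
  by rewrite geq_max => /andP[_ /dboundP].
rewrite (dliftE xn) (dliftE yn) (@dliftE _ n) => [|i ni]; last first.
  by rewrite dcoefD dcoefZ xn // yn // scaler0 addr0.
rewrite scaler_sumr -big_split /=; apply: eq_bigr => i _.
exact: fL.
Qed.

End Lift.

Lemma dsum_ind (Q : D -> Prop) :
  Q 0 -> (forall x y, Q x -> Q y -> Q (x + y)) ->
  (forall i (x : V i), Q (dinj x)) -> forall x, Q x.
Proof.
by move=> Q0 QD Qi x; rewrite (dsumE (@dboundP x)); apply: big_ind.
Qed.

End DirectSum.

(* Indices are shifted by one: tpow R n is the tensor power R^{(x) (n+1)},
   and the component of index n of an element of Sh(R) lies in it. *)
Fixpoint tpow (k : comNzRingType) (R : comAlgType k) (n : nat) : lmodType k :=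
  if n is n'.+1 then tensor R (tpow R n') else (R : lmodType k).

(* The weight is a parameter because the product of Sh lam R depends on it. *)
Definition Sh (k : comNzRingType) (lam : k) (R : comAlgType k) : Type :=
  dsum (tpow R).

HB.instance Definition _ k lam R := GRing.Lmodule.on (@Sh k lam R).

Section MixableShuffle.
Variables (k : comNzRingType) (lam : k) (R : comAlgType k).
Local Notation T := (tpow R).
Local Notation S := (Sh lam R).

Lemma sh_coefD (x y : S) i : dcoef (x + y) i = dcoef x i + dcoef y i.
Proof. by []. Qed.
Lemma sh_coefZ c (x : S) i : dcoef (c *: x) i = c *: dcoef x i.
Proof. by []. Qed.

Definition sh_in n (x : T n) : S := dinj x.
HB.instance Definition _ n :=
  GRing.isLinear.Build k (T n) S *:%R (@sh_in n) (@dinj_is_linear k T n).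

Definition sh_emb (a : R) : S := @sh_in 0 a.

(* a (x) x, for x in Sh(R) *)
Definition cons_coef (a : R) (x : S) (i : nat) : T i :=
  match i return T i with 0 => 0 | i'.+1 => pure a (dcoef x i') end.

Lemma sh_cons_subproof (a : R) (x : S) :
  exists n : nat, forall i : nat, (n <= i)%N -> cons_coef a x i = 0.
Proof.
case: x => [x [n xn]]; exists n.+1 => -[//|i] ni /=.
by rewrite xn // pure0r.
Qed.

Definition sh_cons (a : R) (x : S) : S := DSum (sh_cons_subproof a x).

Definition sh_P (x : S) : S := sh_cons 1 x.

(* r(b_0 (x) b_1 (x) ...) = (r b_0) (x) b_1 (x) ... *)
Definition tact (n : nat) (r : R) : T n -> T n :=
  match n return T n -> T n with
  | 0 => fun b => r * b
  | n'.+1 => tlift (fun (b0 : R) (b' : T n') => pure (r * b0) b' : T n'.+1)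
  end.

(* In the last case a = a0 (x) a', b = b0 (x) b', and shuf_r n' is the product
   of R^{(x) (m'+2)} with R^{(x) (n'+1)}. *)
Fixpoint shuf (m : nat) : forall n, T m -> T n -> S :=
  match m return forall n, T m -> T n -> S with
  | 0 => fun n a b => sh_in (tact a b)
  | m'.+1 => fix shuf_r (n : nat) : T m'.+1 -> T n -> S :=
    match n return T m'.+1 -> T n -> S with
    | 0 => fun a b => sh_in (tact b a)
    | n'.+1 => fun a b =>
      tlift (fun (a0 : R) (a' : T m') =>
        tlift (fun (b0 : R) (b' : T n') =>
          sh_cons (a0 * b0)
            (@shuf m' n'.+1 a' (pure 1 b') + shuf_r n' (pure 1 a') b'
             + lam *: @shuf m' n' a' b')) b) a
    end
  end.

Definition sh_mul (x y : S) : S :=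
  dlift (fun m (a : T m) => dlift (fun n (b : T n) => shuf a b) y) x.

Lemma sh_consDl a b x : sh_cons (a + b) x = sh_cons a x + sh_cons b x.
Proof. by apply: dsum_ext => -[|i]; rewrite sh_coefD /= ?addr0 ?pureDl. Qed.
Lemma sh_consZl c a x : sh_cons (c *: a) x = c *: sh_cons a x.
Proof. by apply: dsum_ext => -[|i]; rewrite sh_coefZ /= ?scaler0 ?pureZl. Qed.
Lemma sh_cons_is_linear a : linear (sh_cons a).
Proof.
move=> c x y; apply: dsum_ext => -[|i]; rewrite sh_coefD sh_coefZ /=.
  by rewrite scaler0 addr0.
by rewrite pureDr pureZr.
Qed.
HB.instance Definition _ a :=
  GRing.isLinear.Build k S S *:%R (sh_cons a) (sh_cons_is_linear a).
HB.instance Definition _ :=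
  GRing.isLinear.Build k S S *:%R sh_P (sh_cons_is_linear 1).

Lemma sh_cons_in n a (x : T n) : sh_cons a (sh_in x) = @sh_in n.+1 (pure a x).
Proof.
apply: dsum_ext => -[|j] /=; first by rewrite dfwith_out.
have [<-|nj] := eqVneq n j; first by rewrite !dfwith_in.
by rewrite !dfwith_out ?pure0r.
Qed.

Lemma Sh_ind (Q : S -> Prop) :
  Q 0 -> (forall x y, Q x -> Q y -> Q (x + y)) ->
  (forall r, Q (sh_emb r)) -> (forall r x, Q x -> Q (sh_cons r x)) ->
  forall x, Q x.
Proof.
move=> Q0 QD Qe Qc; apply: dsum_ind => //; elim=> [|i IH] //= x.
move: x; apply: tensor_ind => [|x y Qx Qy|m n].
- by rewrite -[dinj _]/(@sh_in i.+1 0) linear0.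
- by rewrite -[dinj _]/(@sh_in i.+1 (x + y)) linearD; apply: QD.
- by rewrite -[dinj _]/(@sh_in i.+1 (pure m n)) -sh_cons_in; apply/Qc/IH.
Qed.

Lemma tact_linl n (b : T n) : linear (fun r => tact r b).
Proof.
move=> c r r'; case: n b => [|n] b /=; first by rewrite mulrDl scalerAl.
rewrite /tlift scaler_sumr -big_split /=; apply: eq_bigr => p _.
by rewrite mulrDl -scalerAl pureDl pureZl.
Qed.

Lemma pure_bil_l n r (b' : T n) : linear (fun b0 : R => pure (r * b0) b').
Proof. by move=> c x y; rewrite mulrDr -scalerAr pureDl pureZl. Qed.

Lemma pure_bil_r n r (b0 : R) : linear (fun b' : T n => pure (r * b0) b').
Proof. by move=> c x y; rewrite pureDr pureZr. Qed.

Lemma tact_linr n r : linear (@tact n r).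
Proof.
case: n => [|n] /=; first by move=> c x y; rewrite mulrDr scalerAr.
by apply: tlift_is_linear => ?; [apply: pure_bil_l|apply: pure_bil_r].
Qed.

Lemma tact_pure n r (b0 : R) (b' : T n) :
  @tact n.+1 r (pure b0 b') = pure (r * b0) b'.
Proof.
by apply: tliftE => ?; [apply: pure_bil_l|apply: pure_bil_r].
Qed.

Definition shuf_cons m n (a0 : R) (a' : T m) (b0 : R) (b' : T n) : S :=
  sh_cons (a0 * b0) (@shuf m n.+1 a' (pure 1 b')
    + @shuf m.+1 n (pure 1 a') b' + lam *: shuf a' b').

Lemma shufSS m n (a : T m.+1) (b : T n.+1) :
  @shuf m.+1 n.+1 a b = tlift (fun (a0 : R) (a' : T m) =>
    tlift (fun (b0 : R) (b' : T n) => shuf_cons a0 a' b0 b') b) a.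
Proof. by []. Qed.

Section ShufLinearStep.
Variables m n : nat.
Hypothesis l1 : forall b, linear (fun a => @shuf m n.+1 a b).
Hypothesis r1 : forall a, linear (@shuf m n.+1 a).
Hypothesis l2 : forall b, linear (fun a => @shuf m.+1 n a b).
Hypothesis r2 : forall a, linear (@shuf m.+1 n a).
Hypothesis l3 : forall b, linear (fun a => @shuf m n a b).
Hypothesis r3 : forall a, linear (@shuf m n a).

Let lin3 (c : k) (x x' y y' z z' : S) :
  c *: x + x' + (c *: y + y') + lam *: (c *: z + z')
  = c *: (x + y + lam *: z) + (x' + y' + lam *: z').
Proof.
rewrite !scalerDr !scalerA (mulrC lam) -!addrA; congr (_ + _).
rewrite addrCA; congr (_ + _); rewrite [RHS]addrCA; congr (_ + _).
by rewrite addrCA.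
Qed.

Lemma shuf_cons_lin1 a' b0 b' : linear (fun a0 => @shuf_cons m n a0 a' b0 b').
Proof.
by move=> c x y; rewrite /shuf_cons mulrDl -scalerAl sh_consDl sh_consZl.
Qed.

Lemma shuf_cons_lin2 a0 b0 b' : linear (fun a' => @shuf_cons m n a0 a' b0 b').
Proof.
move=> c x y; rewrite /shuf_cons pureDr pureZr l1 l2 l3 lin3.
by rewrite linearP.
Qed.

Lemma shuf_cons_lin3 a0 a' b' : linear (fun b0 => @shuf_cons m n a0 a' b0 b').
Proof.
by move=> c x y; rewrite /shuf_cons mulrDr -scalerAr sh_consDl sh_consZl.
Qed.

Lemma shuf_cons_lin4 a0 a' b0 : linear (@shuf_cons m n a0 a' b0).
Proof.
move=> c x y; rewrite /shuf_cons pureDr pureZr r1 r2 r3 lin3.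
by rewrite linearP.
Qed.

Let inner_lin1 a' b :
  linear (fun a0 => tlift (fun b0 b' => @shuf_cons m n a0 a' b0 b') b).
Proof.
move=> c x y; rewrite /tlift scaler_sumr -big_split /=.
by apply: eq_bigr => p _; rewrite shuf_cons_lin1.
Qed.

Let inner_lin2 a0 b :
  linear (fun a' => tlift (fun b0 b' => @shuf_cons m n a0 a' b0 b') b).
Proof.
move=> c x y; rewrite /tlift scaler_sumr -big_split /=.
by apply: eq_bigr => p _; rewrite shuf_cons_lin2.
Qed.

Lemma shuf_step_l b : linear (fun a => @shuf m.+1 n.+1 a b).
Proof.
move=> c x y; rewrite !shufSS.
apply: tlift_is_linear => ?; [exact: inner_lin1|exact: inner_lin2].
Qed.

Lemma shuf_step_r a : linear (@shuf m.+1 n.+1 a).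
Proof.
move=> c x y; rewrite !shufSS /tlift scaler_sumr -big_split /=.
apply: eq_bigr => p _; apply: tlift_is_linear => ?.
  exact: shuf_cons_lin3.
exact: shuf_cons_lin4.
Qed.

Lemma shuf_step_pure a0 a' b0 b' :
  @shuf m.+1 n.+1 (pure a0 a') (pure b0 b') = shuf_cons a0 a' b0 b'.
Proof.
rewrite shufSS tliftE => [|a|a]; [|exact: inner_lin1|exact: inner_lin2].
by rewrite tliftE // => ?; [exact: shuf_cons_lin3|exact: shuf_cons_lin4].
Qed.

End ShufLinearStep.

Lemma shuf_lin m n :
  (forall b, linear (fun a => @shuf m n a b)) /\
  (forall a, linear (@shuf m n a)).
Proof.
elim: m n => [|m IHm] n.
  split=> [b|a] c x y /=; first by rewrite tact_linl linearP.
  by rewrite tact_linr linearP.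
elim: n => [|n [IHl IHr]].
  split=> [b|a] c x y.
    by rewrite [LHS]/(sh_in _) tact_linr linearP.
  by rewrite [LHS]/(sh_in _) tact_linl linearP.
have [l1 r1] := IHm n.+1; have [l3 r3] := IHm n.
split; [exact: (shuf_step_l l1 IHl l3)|exact: (shuf_step_r r1 IHr r3)].
Qed.

Lemma shuf_pure m n a0 (a' : T m) b0 (b' : T n) :
  @shuf m.+1 n.+1 (pure a0 a') (pure b0 b')
  = sh_cons (a0 * b0) (@shuf m n.+1 a' (pure 1 b')
    + @shuf m.+1 n (pure 1 a') b' + lam *: shuf a' b').
Proof.
have [l1 r1] := shuf_lin m n.+1; have [l2 r2] := shuf_lin m.+1 n.
by have [l3 r3] := shuf_lin m n; apply: shuf_step_pure.
Qed.

Lemma sh_mul_linr x : linear (sh_mul x).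
Proof.
move=> c y z; rewrite /sh_mul /dlift scaler_sumr -big_split /=.
apply: eq_bigr => i _.
apply: (@dlift_is_linear _ _ _ (fun j b => shuf (dcoef x i) b)) => j.
by have [_] := shuf_lin i j; apply.
Qed.

Lemma sh_mul_linl y : linear (sh_mul^~ y).
Proof.
apply: (@dlift_is_linear _ _ _
  (fun m (a : T m) => dlift (fun n (b : T n) => shuf a b) y)) => i c a b.
rewrite /dlift scaler_sumr -big_split /=.
by apply: eq_bigr => j _; have [->] := shuf_lin i j.
Qed.

Lemma sh_mul_in m n (a : T m) (b : T n) : sh_mul (sh_in a) (sh_in b) = shuf a b.
Proof.
rewrite /sh_mul dlift_inj => [|i c x y]; last first.
  rewrite /dlift scaler_sumr -big_split /=.
  by apply: eq_bigr => j _; have [->] := shuf_lin i j.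
by rewrite dlift_inj // => i; have [_] := shuf_lin m i; apply.
Qed.

Lemma sh_mulDl x y z : sh_mul (x + y) z = sh_mul x z + sh_mul y z.
Proof. by have := sh_mul_linl z 1 x y; rewrite !scale1r. Qed.
Lemma sh_mulDr x y z : sh_mul x (y + z) = sh_mul x y + sh_mul x z.
Proof. by have := sh_mul_linr x 1 y z; rewrite !scale1r. Qed.
Lemma sh_mul0l x : sh_mul 0 x = 0.
Proof. by apply: (addrI (sh_mul 0 x)); rewrite -sh_mulDl !addr0. Qed.
Lemma sh_mul0r x : sh_mul x 0 = 0.
Proof. by apply: (addrI (sh_mul x 0)); rewrite -sh_mulDr !addr0. Qed.
Lemma sh_mulZl c x y : sh_mul (c *: x) y = c *: sh_mul x y.
Proof. by have := sh_mul_linl y c x 0; rewrite sh_mul0l !addr0. Qed.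
Lemma sh_mulZr c x y : sh_mul x (c *: y) = c *: sh_mul x y.
Proof. by have := sh_mul_linr x c y 0; rewrite sh_mul0r !addr0. Qed.

Lemma Sh_ind_in (Q : S -> Prop) :
  Q 0 -> (forall x y, Q x -> Q y -> Q (x + y)) ->
  (forall n (x : T n), Q (sh_in x)) -> forall x, Q x.
Proof. exact: dsum_ind. Qed.

Lemma sh_mul_emb a b : sh_mul (sh_emb a) (sh_emb b) = sh_emb (a * b).
Proof. by rewrite sh_mul_in. Qed.

Lemma sh_mul_emb_cons a b y :
  sh_mul (sh_emb a) (sh_cons b y) = sh_cons (a * b) y.
Proof.
elim/Sh_ind_in: y => [|x y Qx Qy|n y].
- by rewrite !linear0 sh_mul0r.
- by rewrite !linearD sh_mulDr Qx Qy.
- by rewrite !sh_cons_in sh_mul_in -tact_pure.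
Qed.

Lemma sh_mul_cons_emb a b y :
  sh_mul (sh_cons b y) (sh_emb a) = sh_cons (a * b) y.
Proof.
elim/Sh_ind_in: y => [|x y Qx Qy|n y].
- by rewrite !linear0 sh_mul0l.
- by rewrite !linearD sh_mulDl Qx Qy.
- by rewrite !sh_cons_in sh_mul_in -tact_pure.
Qed.

Lemma sh_mul_cons a x b y : sh_mul (sh_cons a x) (sh_cons b y) =
  sh_cons (a * b) (sh_mul x (sh_P y) + sh_mul (sh_P x) y + lam *: sh_mul x y).
Proof.
have perm4 (s t u v w z : S) :
    s + t + (u + v) + (w + z) = (s + u + w) + (t + v + z).
  by rewrite (addrACA s) (addrACA (s + u)).
elim/Sh_ind_in: x => [|x x' Qx Qx'|m x].
- by rewrite !(linear0, sh_mul0l, scaler0, addr0).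
- by rewrite (linearD (sh_cons a)) (linearD sh_P) !sh_mulDl Qx Qx' scalerDr perm4
    [RHS](linearD (sh_cons (a * b))).
elim/Sh_ind_in: y => [|y y' Qy Qy'|n y].
- by rewrite !(linear0, sh_mul0r, scaler0, addr0).
- by rewrite (linearD (sh_cons b)) (linearD sh_P) !sh_mulDr Qy Qy' scalerDr perm4
    [RHS](linearD (sh_cons (a * b))).
by rewrite /sh_P !sh_cons_in !sh_mul_in shuf_pure.
Qed.

Lemma sh_mulC : commutative sh_mul.
Proof.
elim/Sh_ind => [|x x' Qx Qx'|r|r x Qx] y.
- by rewrite sh_mul0l sh_mul0r.
- by rewrite sh_mulDl sh_mulDr Qx Qx'.
- elim/Sh_ind: y => [|y y' Qy Qy'|s|s y _].
  + by rewrite sh_mul0l sh_mul0r.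
  + by rewrite sh_mulDl sh_mulDr Qy Qy'.
  + by rewrite !sh_mul_emb mulrC.
  + by rewrite sh_mul_emb_cons sh_mul_cons_emb.
- elim/Sh_ind: y r => [|y y' Qy Qy'|s|s y Qy] r.
  + by rewrite sh_mul0l sh_mul0r.
  + by rewrite sh_mulDl sh_mulDr Qy Qy'.
  + by rewrite sh_mul_emb_cons sh_mul_cons_emb.
  + rewrite !sh_mul_cons mulrC !Qx [sh_mul (sh_P x) y]Qy.
    by congr (sh_cons _ (_ + _)); rewrite addrC.
Qed.

Definition sh1 : S := sh_emb 1.

Lemma sh_mul1 : left_id sh1 sh_mul.
Proof.
elim/Sh_ind => [|x y Qx Qy|r|r x _].
- by rewrite sh_mul0r.
- by rewrite sh_mulDr Qx Qy.
- by rewrite sh_mul_emb mul1r.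
- by rewrite sh_mul_emb_cons mul1r.
Qed.

Lemma sh_mul_embA r x y :
  sh_mul (sh_emb r) (sh_mul x y) = sh_mul (sh_mul (sh_emb r) x) y.
Proof.
elim/Sh_ind: x => [|x x' Qx Qx'|a|a x _].
- by rewrite !(sh_mul0l, sh_mul0r).
- by rewrite !(sh_mulDl, sh_mulDr) Qx Qx'.
- elim/Sh_ind: y => [|y y' Qy Qy'|b|b y _].
  + by rewrite !(sh_mul0l, sh_mul0r).
  + by rewrite !sh_mulDr Qy Qy'.
  + by rewrite !sh_mul_emb mulrA.
  + by rewrite !(sh_mul_emb, sh_mul_emb_cons) mulrA.
- elim/Sh_ind: y => [|y y' Qy Qy'|b|b y _].
  + by rewrite !(sh_mul0l, sh_mul0r).
  + by rewrite !sh_mulDr Qy Qy'.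
  + by rewrite sh_mul_emb_cons !sh_mul_cons_emb sh_mul_emb_cons mulrCA.
  + by rewrite sh_mul_emb_cons !sh_mul_cons sh_mul_emb_cons mulrA.
Qed.

Lemma sh_mulP x y : sh_mul (sh_P x) (sh_P y) =
  sh_P (sh_mul x (sh_P y) + sh_mul (sh_P x) y + lam *: sh_mul x y).
Proof. by rewrite sh_mul_cons mul1r. Qed.

Lemma sh_mulA : associative sh_mul.
Proof.
have perm7 (s t u v w p z : S) : s + (t + u + v) + (w + p + z)
    = s + t + w + u + (p + v + z).
  rewrite -!addrA; congr (_ + (_ + _)); rewrite [RHS]addrCA; congr (_ + _).
  by rewrite addrCA; congr (_ + _); rewrite addrCA.
elim/Sh_ind => [|x x' Qx Qx'|r|a x Qx] y z.
- by rewrite !sh_mul0l.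
- by rewrite !sh_mulDl Qx Qx'.
- exact: sh_mul_embA.
elim/Sh_ind: y a z => [|y y' Qy Qy'|r|b y Qy] a z.
- by rewrite !(sh_mul0l, sh_mul0r).
- by rewrite !(sh_mulDl, sh_mulDr) Qy Qy'.
- by rewrite [sh_mul (sh_cons a x) (sh_emb r)]sh_mulC -sh_mul_embA
    [LHS]sh_mulC -sh_mul_embA [sh_mul z _]sh_mulC.
elim/Sh_ind: z a b => [|z z' Qz Qz'|r|c z Qz] a b.
- by rewrite !sh_mul0r.
- by rewrite !sh_mulDr Qz Qz'.
- rewrite [RHS]sh_mulC sh_mul_embA [sh_mul _ (sh_emb r)]sh_mulC.
  rewrite sh_mul_emb_cons [sh_mul (sh_emb r) _]sh_mul_emb_cons.
  by rewrite !sh_mul_cons mulrCA mulrA.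
rewrite [sh_mul (sh_cons b y) _]sh_mul_cons [sh_mul (sh_cons a x) (sh_cons b y)]
  sh_mul_cons !sh_mul_cons mulrA -!sh_mulP.
congr sh_cons; rewrite !(sh_mulDl, sh_mulDr, sh_mulZl, sh_mulZr, scalerDr).
rewrite !Qx !Qy -/(sh_P x) Qz; exact: perm7.
Qed.

Lemma sh1_neq0 : sh1 != 0.
Proof.
apply/eqP => /(congr1 (fun x : S => dcoef x 0)).
by rewrite /sh1 /= dfwith_in => /eqP; rewrite oner_eq0.
Qed.

End MixableShuffle.

HB.instance Definition _ (k : comNzRingType) (lam : k) (R : comAlgType k) :=
  GRing.Zmodule_isComNzRing.Build (Sh lam R)
    (@sh_mulA k lam R) (@sh_mulC k lam R) (@sh_mul1 k lam R)
    (fun x y z => @sh_mulDl k lam R x y z) (sh1_neq0 lam R).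
HB.instance Definition _ (k : comNzRingType) (lam : k) (R : comAlgType k) :=
  GRing.Lmodule_isLalgebra.Build k (Sh lam R)
    (fun c x y => esym (@sh_mulZl k lam R c x y)).
HB.instance Definition _ (k : comNzRingType) (lam : k) (R : comAlgType k) :=
  GRing.Lalgebra_isComAlgebra.Build k (Sh lam R).

(* The submodule R (+) R^{(x) 2} (+) ... (+) R^{(x) n} of Sh(R). *)
Definition sh_upto (k : comNzRingType) (lam : k) (R : comAlgType k) (n : nat)
    (x : Sh lam R) : Prop :=
  forall i, (n <= i)%N -> dcoef x i = 0.

Definition poly_op (k : comNzRingType) (V : lmodType k) (p : {poly k})
    (f : V -> V) (x : V) : V :=
  \sum_(i < size p) p`_i *: iter i f x.

Definition rota_baxter (k : comNzRingType) (lam : k) (A : comAlgType k)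
    (P : {linear A -> A}) : Prop :=
  forall x y, P x * P y = P (P x * y) + P (x * P y) + lam *: P (x * y).

(* The element xy - (phi(x) + y psi(x)) of Omega, given by phi and psi, which
   it determines. *)
Record Omega (k : comNzRingType) := OmegaPoly {
  omega_phi : {poly k};
  omega_psi : {poly k} }.

Definition omega_vanishes (k : comNzRingType) (w : Omega k) (V : lmodType k)
    (q P : {linear V -> V}) : Prop :=
  forall x, q (P x) = poly_op (omega_phi w) q x + P (poly_op (omega_psi w) q x).

Definition type_omega_RB (k : comNzRingType) (w : Omega k) (lam : k)
    (A : comAlgType k) (q P : {linear A -> A}) : Prop :=
  [/\ q 1 = 0, rota_baxter lam P & omega_vanishes w q P].

Section Extension.
Variables (k : comNzRingType) (lam : k) (R : comAlgType k).
Variables (q : {linear R -> R}) (w : Omega k) (qh : {linear Sh lam R -> Sh lam R}).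

Definition extends : Prop := forall a : R, qh (sh_emb lam a) = sh_emb lam (q a).

(* u' ranges over R^{(x) n}, n >= 1, which is tpow R m for n = m.+1. *)
Definition omega_formula : Prop :=
  forall (m : nat) (u0 : R) (u' : tpow R m),
    qh (@sh_in k lam R m.+1 (pure u0 u'))
    = @sh_in k lam R m.+1 (pure (q u0) u')
      + sh_emb lam (u0 + lam *: q u0)
        * (poly_op (omega_phi w) qh (sh_in lam u')
           + sh_P (poly_op (omega_psi w) qh (sh_in lam u'))).

Definition preserves_upto : Prop :=
  forall n : nat, (0 < n)%N ->
    forall x : Sh lam R, sh_upto n x -> sh_upto n (qh x).

Definition omega_extension : Prop :=
  [/\ extends, omega_formula & preserves_upto].

End Extension.

(* Main.v *)
(** Let [step g] be the map that sends [emb a] to [emb (q a)] and [u0 (x) u'] to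
    the right-hand side of the formula with [g] in place of the extension.  The
    admissible extensions are the fixed points of [step].  The value of [step g]
    on tensors of length at most n+1 depends only on [g] on tensors of length at
    most n, provided that [g] preserves the length filtration; hence the iterates
    of [step] at 0 stabilize on each filtration piece to a fixed point, which is
    unique. *)
Require Import Defs.
From HB Require Import structures.
From mathcomp Require Import all_boot all_algebra.

Set Implicit Arguments.
Unset Strict Implicit.
Unset Printing Implicit Defensive.

Import GRing.Theory.
Local Open Scope ring_scope.

(** * Polynomials evaluated at an operator *)

Section PolyOp.
Variables (k : comNzRingType) (V : lmodType k).
Implicit Types (p : {poly k}) (f g : {linear V -> V}).

Lemma iter_linear f i : linear (iter i f).
Proof. by elim: i => [|i IH] c x y //=; rewrite IH linearP. Qed.

Lemma poly_op_linear p f : linear (poly_op p f).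
Proof.
move=> c x y; rewrite /poly_op scaler_sumr -big_split /=.
apply: eq_bigr => i _.
by rewrite iter_linear scalerDr !scalerA mulrC.
Qed.
HB.instance Definition _ p f :=
  GRing.isLinear.Build k V V *:%R (poly_op p f) (poly_op_linear p f).

(** The iterates of [f] from [x] never leave [Q], so [f] and [g] take the same value at each of
    them. *)
Lemma eq_poly_op_on (Q : V -> Prop) p f g x :
  (forall y, Q y -> Q (f y)) -> (forall y, Q y -> f y = g y) -> Q x ->
  poly_op p f x = poly_op p g x.
Proof.
move=> Qf fg Qx; apply: eq_bigr => i _; congr (_ *: _).
suff [] : iter i f x = iter i g x /\ Q (iter i f x) by [].
by elim: (i : nat) => //= j [<- Qj]; split; [apply: fg | apply: Qf].
Qed.

End PolyOp.

(** * The length filtration of [Sh lam R] *)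

Section Filtration.
Variables (k : comNzRingType) (lam : k) (R : comAlgType k).
Local Notation T := (tpow R).
Local Notation S := (Sh lam R).
Implicit Types x y : S.

Lemma sh_upto0 n : sh_upto n (0 : S).
Proof. by []. Qed.

Lemma sh_upto_eq0 x : sh_upto 0 x -> x = 0.
Proof. by move=> x0; apply: dsum_ext => i; apply: x0. Qed.

Lemma sh_uptoD n x y : sh_upto n x -> sh_upto n y -> sh_upto n (x + y).
Proof. by move=> xn yn i ni; rewrite sh_coefD xn // yn // addr0. Qed.

Lemma sh_uptoZ n c x : sh_upto n x -> sh_upto n (c *: x).
Proof. by move=> xn i ni; rewrite sh_coefZ xn // scaler0. Qed.

Lemma sh_uptoW m n x : (m <= n)%N -> sh_upto m x -> sh_upto n x.
Proof. by move=> mn xm i ni; apply/xm/(leq_trans mn). Qed.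

Lemma sh_upto_in m (a : T m) : sh_upto m.+1 (sh_in lam a).
Proof. by move=> i mi; rewrite /sh_in dinjNE // ltn_eqF. Qed.

Lemma sh_upto_cons n (a : R) x : sh_upto n x -> sh_upto n.+1 (sh_cons a x).
Proof. by move=> xn [|i] //= ni; rewrite xn // pure0r. Qed.

Lemma sh_upto_ind_in n (Q : S -> Prop) :
  Q 0 -> (forall x y, Q x -> Q y -> Q (x + y)) ->
  (forall m (a : T m), (m < n)%N -> Q (sh_in lam a)) ->
  forall x, sh_upto n x -> Q x.
Proof.
move=> Q0 QD Qi x xn; rewrite (dsumE xn).
by apply: (big_ind Q) => // i _; apply: Qi.
Qed.

(** Longer tensors are sums of pure ones, each a [sh_cons] with tail one piece lower; the inductions
    on [step] use this drop. *)
Lemma sh_upto_ind n (Q : S -> Prop) :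
  Q 0 -> (forall x y, Q x -> Q y -> Q (x + y)) ->
  (forall a, Q (sh_emb lam a)) ->
  (forall a x, sh_upto n x -> Q (sh_cons a x)) ->
  forall x, sh_upto n.+1 x -> Q x.
Proof.
move=> Q0 QD Qe Qc; apply: sh_upto_ind_in => // -[|m] a.
  by move=> _; apply: Qe.
rewrite ltnS => mn; elim/tensor_ind: a => [|a b Qa Qb|a b].
- by rewrite linear0.
- by rewrite linearD; apply: QD.
- by rewrite -sh_cons_in; apply/Qc/(sh_uptoW mn)/sh_upto_in.
Qed.

Lemma sh_upto_mul_emb n (a : R) x : sh_upto n x -> sh_upto n (sh_emb lam a * x).
Proof.
case: n => [|n] xn.
  by rewrite (sh_upto_eq0 xn) mulr0; apply: sh_upto0.
move: x xn; apply: sh_upto_ind => [|x y xn yn|b|b x xn].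
- by rewrite mulr0; apply: sh_upto0.
- by rewrite mulrDr; apply: sh_uptoD.
- rewrite [_ * _]sh_mul_emb.
  by apply: (@sh_uptoW 1) => //; apply: (@sh_upto_in 0).
- by rewrite [_ * _]sh_mul_emb_cons; apply: sh_upto_cons.
Qed.

Lemma sh_upto_poly_op n p (g : {linear S -> S}) x :
  (forall y, sh_upto n y -> sh_upto n (g y)) ->
  sh_upto n x -> sh_upto n (poly_op p g x).
Proof.
move=> gn xn; apply: (big_ind (@sh_upto k lam R n)); first exact: sh_upto0.
  by move=> y z; apply: sh_uptoD.
move=> i _; apply: sh_uptoZ; elim: (i : nat) => //= j IH; exact: gn.
Qed.

End Filtration.

(** * The right-hand side of the formula as a linear map *)

Section Step.
Variables (k : comNzRingType) (lam : k) (R : comAlgType k).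
Variables (q : {linear R -> R}) (phi psi : {poly k}).
Local Notation T := (tpow R).
Local Notation S := (Sh lam R).
Implicit Types (g h : {linear S -> S}) (x y : S) (a : R).

(** The tail [y] may mix lengths, so that this is linear in [y] on all of [S]. *)
Definition step_cons g a y : S :=
  sh_cons (q a) y
  + sh_emb lam (a + lam *: q a) * (poly_op phi g y + sh_P (poly_op psi g y)).

Lemma step_cons_linl g y : linear ((step_cons g)^~ y).
Proof.
move=> c a b; rewrite /step_cons linearP /= sh_consDl sh_consZl.
have -> : c *: a + b + lam *: (c *: q a + q b)
    = c *: (a + lam *: q a) + (b + lam *: q b).
  by rewrite !scalerDr !scalerA (mulrC lam) addrACA.
rewrite [sh_emb lam _](linearP (@sh_in k lam R 0)) mulrDl -scalerAl scalerDr.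
by rewrite addrACA.
Qed.

Lemma step_cons_linr g a : linear (step_cons g a).
Proof.
move=> c x y; rewrite /step_cons !linearP /= addrACA -scalerDr mulrDr -scalerAr.
by rewrite scalerDr addrACA.
Qed.

Definition step_in g m : T m -> S :=
  match m return T m -> S with
  | 0 => fun a => sh_emb lam (q a)
  | m'.+1 => tlift (fun a (u : T m') => step_cons g a (sh_in lam u))
  end.

Lemma step_cons_in_linr g a m :
  linear (fun u : T m => step_cons g a (sh_in lam u)).
Proof. by move=> c u v; rewrite linearP step_cons_linr. Qed.

Lemma step_in_linear g m : linear (@step_in g m).
Proof.
case: m => [|m] /=; last first.
  apply: tlift_is_linear => [u|a]; first exact: step_cons_linl.
  exact: step_cons_in_linr.
by move=> c a b; rewrite linearP [LHS](linearP (@sh_in k lam R 0)).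
Qed.

Definition step g : S -> S := dlift (@step_in g).

Lemma step_is_linear g : linear (step g).
Proof. exact/dlift_is_linear/step_in_linear. Qed.
HB.instance Definition _ g :=
  GRing.isLinear.Build k S S *:%R (step g) (step_is_linear g).

Lemma step_emb g a : step g (sh_emb lam a) = sh_emb lam (q a).
Proof. exact: (dlift_inj (@step_in_linear g)). Qed.

Lemma step_pure g m a (u : T m) :
  step g (@sh_in k lam R m.+1 (pure a u)) = step_cons g a (sh_in lam u).
Proof.
rewrite [LHS](dlift_inj (@step_in_linear g)) /=.
by apply: tliftE => ?; [apply: step_cons_linl | apply: step_cons_in_linr].
Qed.

(** Both sides are linear in [y], which reduces the claim to homogeneous tails. *)
Lemma step_sh_cons g a y : step g (sh_cons a y) = step_cons g a y.
Proof.
elim/Sh_ind_in: y => [|x y Qx Qy|n y].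
- by rewrite !linear0 /step_cons !linear0 addr0 mulr0 addr0.
- rewrite (linearD (sh_cons a)) linearD /= Qx Qy.
  by have := step_cons_linr g a 1 x y; rewrite !scale1r.
- by rewrite sh_cons_in step_pure.
Qed.

(** * Fixed points of [step] and their uniqueness *)

Definition preserves_filtration (g : S -> S) : Prop :=
  forall n x, sh_upto n x -> sh_upto n (g x).

(** The tail is one shorter than the whole tensor, which makes room for the factor that [sh_P]
    adds. *)
Lemma step_preserves g : preserves_filtration g -> preserves_filtration (step g).
Proof.
move=> gP [|n] x xn.
  by rewrite (sh_upto_eq0 xn) linear0; apply: sh_upto0.
move: x xn; apply: sh_upto_ind => [|x y xn yn|a|a x xn].
- by rewrite linear0; apply: sh_upto0.
- by rewrite linearD; apply: sh_uptoD.
- rewrite step_emb.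
  by apply: (@sh_uptoW _ _ _ 1) => //; apply: (@sh_upto_in _ _ _ 0).
- have pP p : sh_upto n (poly_op p g x).
    by apply: sh_upto_poly_op => // y; apply: gP.
  rewrite step_sh_cons; apply: sh_uptoD; first exact: sh_upto_cons.
  apply/sh_upto_mul_emb/sh_uptoD; last exact: sh_upto_cons.
  exact: sh_uptoW (pP phi).
Qed.

(** On [sh_cons a x], [step g] sees [g] only through its iterates at the tail [x], and these stay in
    piece [n]. *)
Lemma eq_step_upto g h n : preserves_filtration g ->
  (forall x, sh_upto n x -> g x = h x) ->
  forall x, sh_upto n.+1 x -> step g x = step h x.
Proof.
move=> gP gh; apply: sh_upto_ind => [|x y Qx Qy|a|a x xn].
- by rewrite !linear0.
- by rewrite !linearD /= Qx Qy.
- by rewrite !step_emb.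
- rewrite !step_sh_cons /step_cons.
  by rewrite !(eq_poly_op_on (Q := @sh_upto k lam R n) _ (gP n) gh xn).
Qed.

Lemma fixpoint_omega_extension g : preserves_filtration g ->
  step g =1 g -> omega_extension q (OmegaPoly phi psi) g.
Proof.
move=> gP gE; split=> [a|m a u|n _ x]; last exact: gP.
  by rewrite -gE step_emb.
by rewrite -gE step_pure /step_cons sh_cons_in.
Qed.

Lemma omega_extension_fixpoint g :
  omega_extension q (OmegaPoly phi psi) g -> step g =1 g.
Proof.
move=> [ge gf _]; elim/Sh_ind_in=> [|x y Qx Qy|[|m] u].
- by rewrite !linear0.
- by rewrite !linearD /= Qx Qy.
- by rewrite [LHS]step_emb [RHS]ge.
- elim/tensor_ind: u => [|u v Qu Qv|a u].
  + by rewrite !linear0.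
  + by rewrite !linearD /= Qu Qv.
  + by rewrite step_pure gf /step_cons sh_cons_in.
Qed.

(** Piece 0 is zero, and [eq_step_upto] carries agreement of two fixed points from piece [n] to
    piece [n.+1]. *)
Lemma step_fixpoint_unique g h : preserves_filtration g ->
  step g =1 g -> step h =1 h -> h =1 g.
Proof.
move=> gP gE hE x.
suff gh n : forall y, sh_upto n y -> g y = h y.
  by apply/esym/(gh (dbound x)) => i; apply: dboundP.
elim: n => [|n IH] y yn; last first.
  by rewrite -gE -hE; apply: eq_step_upto yn.
by rewrite (sh_upto_eq0 yn) !linear0.
Qed.

(** * Existence: the limit of the iterates of [step] at 0 *)

Fixpoint step_iter n : {linear S -> S} :=
  if n is n'.+1 then step (step_iter n') else @GRing.null_fun S S.

Lemma step_iter_preserves n : preserves_filtration (step_iter n).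
Proof.
elim: n => [|n IH]; last exact: step_preserves.
by move=> n x _; apply: sh_upto0.
Qed.

Lemma step_iter_stable m n x :
  sh_upto n x -> (n <= m)%N -> step_iter m x = step_iter n x.
Proof.
elim: n m x => [|n IH] m x xn.
  by rewrite (sh_upto_eq0 xn) !linear0.
case: m => // m nm; apply: eq_step_upto xn; first exact: step_iter_preserves.
by move=> y yn; apply: IH.
Qed.

(** A tensor of index [m] has length [m.+1], and on that piece the iterates are constant from the
    [m.+1]-st on. *)
Definition step_limit : S -> S :=
  dlift (fun m (u : T m) => step_iter m.+1 (sh_in lam u)).

Lemma step_limit_in_linear m :
  linear (fun u : T m => step_iter m.+1 (sh_in lam u)).
Proof. by move=> c u v; rewrite !linearP. Qed.

Lemma step_limit_linear : linear step_limit.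
Proof. exact/dlift_is_linear/step_limit_in_linear. Qed.
HB.instance Definition _ :=
  GRing.isLinear.Build k S S *:%R step_limit step_limit_linear.

Lemma step_limit_upto n x : sh_upto n x -> step_limit x = step_iter n x.
Proof.
move: x; apply: sh_upto_ind_in => [|x y Qx Qy|m u mn].
- by rewrite !linear0.
- by rewrite !linearD /= Qx Qy.
- rewrite [LHS](dlift_inj step_limit_in_linear).
  by apply/esym/step_iter_stable => //; apply: sh_upto_in.
Qed.

Lemma step_limit_preserves : preserves_filtration step_limit.
Proof.
by move=> n x xn; rewrite (step_limit_upto xn); apply: step_iter_preserves.
Qed.

Lemma step_limit_fixpoint : step step_limit =1 step_limit.
Proof.
move=> x; have xn : sh_upto (dbound x) x by move=> i; apply: dboundP.
(* Viewing [x] one piece higher turns the limit at [x] into [step] of an iterate that agrees with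
   the limit one piece below. *)
rewrite (step_limit_upto (sh_uptoW (leqnSn _) xn)) /=.
apply: eq_step_upto (sh_uptoW (leqnSn _) xn); first exact: step_limit_preserves.
by move=> y; apply: step_limit_upto.
Qed.

(** As [sh_P x] is [sh_cons 1 x], the condition [q 1 = 0] kills the first term of the formula and
    leaves the coefficient 1 in the second. *)
Lemma fixpoint_sh_P g x : q 1 = 0 -> step g =1 g ->
  g (sh_P x) = poly_op phi g x + sh_P (poly_op psi g x).
Proof.
move=> q1 gE; rewrite -gE [LHS]step_sh_cons /step_cons q1 scaler0 addr0.
by rewrite -(scale0r 1) sh_consZl scale0r add0r mul1r.
Qed.

End Step.

Lemma sh_P_rota_baxter (k : comNzRingType) (lam : k) (R : comAlgType k) :
  rota_baxter lam (@sh_P k lam R).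
Proof.
(* [sh_mulP] lists the two mixed terms in the opposite order. *)
move=> x y; rewrite [LHS]sh_mulP !linearD linearZ /=.
by congr (_ + _); rewrite addrC.
Qed.

Theorem proposition2p9 (k : comNzRingType) (lam : k) (R : comAlgType k)
    (q : {linear R -> R}) (q1 : q 1 = 0) (phi psi : {poly k}) :
  exists qh : {linear Sh lam R -> Sh lam R},
    [/\ omega_extension q (OmegaPoly phi psi) qh,
        (forall qh' : {linear Sh lam R -> Sh lam R},
           omega_extension q (OmegaPoly phi psi) qh' -> qh' =1 qh),
        (forall x : Sh lam R,
           qh (sh_P x) = poly_op phi qh x + sh_P (poly_op psi qh x)) &
        type_omega_RB (OmegaPoly phi psi) lam qh (@sh_P k lam R)].
Proof.
pose qh : {linear Sh lam R -> Sh lam R} := @step_limit k lam R q phi psi.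
have qhE : step q phi psi qh =1 qh := @step_limit_fixpoint k lam R q phi psi.
have qhP : preserves_filtration qh := @step_limit_preserves k lam R q phi psi.
(* This serves twice: as the stated identity and as [omega_vanishes]. *)
have qh_sh_P x := fixpoint_sh_P x q1 qhE.
exists qh; split=> //; first exact: fixpoint_omega_extension.
  move=> h /omega_extension_fixpoint; exact: step_fixpoint_unique.
split=> //; last exact: sh_P_rota_baxter.
(* The unit of [Sh lam R] is [sh_emb lam 1], so its image is the embedding of [q 1]. *)
by rewrite -[qh 1]qhE [LHS]step_emb q1 [LHS](linear0 (@sh_in k lam R 0)).
Qed.
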